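(* Let $\alpha\in(0,1)$. Then the following statements hold. (i) $f\in\mathrm{VMO}_\alpha$ if and only if $f\in\mathrm{BMO}_\alpha$ and $$\lim_{a\to0^+}\ \sup_{x,y\in\mathbb{R}^n,\,0<|x-y|\le a}\frac{|f(x)-f(y)|}{|x-y|^\alpha}=0.$$ (ii) $f\in\mathrm{XMO}_\alpha$ if and only if $f\in\mathrm{VMO}_\alpha$ and, for any given cube $Q$, $$\lim_{z\to\infty}\ \sup_{x,y\in Q+z,\,x\ne y}\frac{|f(x)-f(y)|}{|x-y|^\alpha}=0.$$ (iii) $f\in\mathrm{CMO}_\alpha$ if and only if $f\in\mathrm{XMO}_\alpha$ and $$\lim_{a\to\infty}\ \sup_{x,y\in\mathbb{R}^n,\,|x-y|\ge a}\frac{|f(x)-f(y)|}{|x-y|^\alpha}=0.$$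
   Context: Everything is on $\mathbb{R}^n$; $\ell(Q)$ is the edge length of a cube $Q$; $Q+z$ is the translate of $Q$ by $z$; $z\to\infty$ means $|z|\to\infty$; $\langle f\rangle_Q:=\frac1{|Q|}\int_Q f$. For $\alpha\in(0,1)$ and $f\in L^1_{\rm loc}$ put $\mathcal{O}_\alpha(f;Q):=|Q|^{-1-\frac{\alpha}{n}}\int_Q|f(x)-\langle f\rangle_Q|\,dx$. Then $\mathrm{BMO}_\alpha$ is the set of $f\in L^1_{\rm loc}$ with $\sup_Q\mathcal{O}_\alpha(f;Q)<\infty$ (supremum over all cubes); $\mathrm{VMO}_\alpha$ is the set of $f\in\mathrm{BMO}_\alpha$ with $\lim_{a\to0^+}\sup_{\ell(Q)\le a}\mathcal{O}_\alpha(f;Q)=0$; $\mathrm{XMO}_\alpha$ is the set of $f\in\mathrm{VMO}_\alpha$ such that $\lim_{z\to\infty}\mathcal{O}_\alpha(f;Q+z)=0$ for every fixed cube $Q$; $\mathrm{CMO}_\alpha$ is the set of $f\in\mathrm{XMO}_\alpha$ with $\lim_{a\to\infty}\sup_{\ell(Q)\ge a}\mathcal{O}_\alpha(f;Q)=0$. Every $f\in\mathrm{BMO}_\alpha$ with $\alpha\in(0,1)$ agrees almost everywhere with a continuous function (Campanato, Meyers); functions are identified when they are equal a.e., and in the pointwise conditions $f$ denotes its continuous representative. *)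

(* Defs.v *)
From HB Require Import structures.
From mathcomp Require Import all_boot all_order all_algebra.
From mathcomp Require Import all_classical all_reals all_analysis.

Set Implicit Arguments.
Unset Strict Implicit.
Unset Printing Implicit Defensive.

Import Order.TTheory GRing.Theory Num.Theory.
Import numFieldNormedType.Exports.

Local Open Scope classical_set_scope.
Local Open Scope ring_scope.

(* Lebesgue measure on [R^n] is built as an iterated product measure on tuples,
   transported to ['rV[R]_n] and then completed. *)

Section lebesgue_tuple.
Variable R : realType.
Let T := measurableTypeR R.

Definition tcons n (xt : T * n.-tuple T) : n.+1.-tuple T :=
  [the n.+1.-tuple T of xt.1 :: xt.2].

Definition tuncons n (t : n.+1.-tuple T) : T * n.-tuple T :=
  (tnth t ord0, [tuple of behead t]).

Lemma tconsK n : cancel (@tcons n) (@tuncons n).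
Proof. by case=> x t; congr (_, _); exact/val_inj. Qed.

Lemma measurable_tcons n : measurable_fun setT (@tcons n).
Proof. by apply: measurable_cons. Qed.

Lemma measurable_tuncons n : measurable_fun setT (@tuncons n).
Proof.
apply/measurable_fun_pairP; split.
  exact: measurable_tnth.
exact: measurable_behead.
Qed.

Section step.
Local Open Scope ereal_scope.
Variables (n : nat) (m : {sigma_finite_measure set (n.-tuple T) -> \bar R}).

Definition lebesgue_tuple_step : set (n.+1.-tuple T) -> \bar R :=
  pushforward (@lebesgue_measure R \x m) (@tcons n).

Let mpre (A : set (n.+1.-tuple T)) :
  measurable A -> measurable (@tcons n @^-1` A).
Proof.
by move=> mA; rewrite -[X in measurable X]setTI; exact: measurable_tcons.
Qed.

Let step0 : lebesgue_tuple_step set0 = 0.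
Proof. by rewrite /lebesgue_tuple_step /pushforward preimage_set0 measure0. Qed.

Let step_ge0 A : 0 <= lebesgue_tuple_step A.
Proof. exact: (measure_ge0 (@lebesgue_measure R \x m)). Qed.

Let step_sigma_additive : semi_sigma_additive lebesgue_tuple_step.
Proof.
move=> F mF tF mUF; rewrite /lebesgue_tuple_step /pushforward preimage_bigcup.
apply: measure_semi_sigma_additive.
- by move=> k; exact: mpre.
- apply/trivIsetP => /= i j _ _ ij; rewrite -preimage_setI.
  by move/trivIsetP : tF => /(_ _ _ _ _ ij) ->//; rewrite preimage_set0.
- by rewrite -preimage_bigcup; exact: mpre.
Qed.

HB.instance Definition _ := isMeasure.Build _ _ _ lebesgue_tuple_step
  step0 step_ge0 step_sigma_additive.

Let step_sigma_finite : sigma_finite setT lebesgue_tuple_step.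
Proof.
have /sigma_finiteP[F [TF ndF Foo]] := sigma_finiteT (@lebesgue_measure R).
have /sigma_finiteP[G [TG ndG Goo]] := sigma_finiteT m.
exists (fun k => @tuncons n @^-1` (F k `*` G k)).
  apply/esym; rewrite -subTset => t _.
  have [i _ Fi] : (\bigcup_i F i) (tuncons t).1 by rewrite -TF.
  have [j _ Gj] : (\bigcup_j G j) (tuncons t).2 by rewrite -TG.
  exists (maxn i j) => //; split.
  - by move: Fi; exact/subsetPset/ndF/leq_maxl.
  - by move: Gj; exact/subsetPset/ndG/leq_maxr.
move=> k; have [mF Fk] := Foo k; have [mG Gk] := Goo k; split.
  rewrite -[X in measurable X]setTI; apply: measurable_tuncons => //.
  exact: measurableX.
rewrite /lebesgue_tuple_step /pushforward -comp_preimage.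
rewrite (_ : _ \o _ = id) ?preimage_id; last by apply/funext; exact: tconsK.
by rewrite product_measure1E// lte_mul_pinfty// ge0_fin_numE.
Qed.

HB.instance Definition _ := Measure_isSigmaFinite.Build _ _ _
  lebesgue_tuple_step step_sigma_finite.

End step.

Fixpoint lebesgue_tuple n : {sigma_finite_measure set (n.-tuple T) -> \bar R} :=
  match n with
  | 0 => \d_[tuple]
  | k.+1 => lebesgue_tuple_step (lebesgue_tuple k)
  end.

End lebesgue_tuple.

Section lebesgue_rV.
Variables (R : realType) (n : nat).

Definition tuple_of_rV (v : 'rV[R]_n) : n.-tuple (measurableTypeR R) :=
  [tuple v ord0 i | i < n].

Definition rV_of_tuple (t : n.-tuple (measurableTypeR R)) : 'rV[R]_n :=
  \row_i tnth t i.

Lemma rV_of_tupleK : cancel rV_of_tuple tuple_of_rV.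
Proof. by move=> t; apply: eq_from_tnth => i; rewrite tnth_mktuple mxE. Qed.

Lemma tuple_of_rVK : cancel tuple_of_rV rV_of_tuple.
Proof. by move=> v; apply/rowP => i; rewrite mxE tnth_mktuple. Qed.

(* The product sigma-algebra on ['rV[R]_n], generated by the coordinates. *)
Definition borel_rV := g_sigma_algebra_preimageType tuple_of_rV.
HB.instance Definition _ := Measurable.on borel_rV.

Definition lebesgue_borel_rV : set borel_rV -> \bar R :=
  pushforward (lebesgue_tuple R n) (rV_of_tuple : _ -> borel_rV).

Let mpre (A : set borel_rV) :
  measurable A -> measurable (rV_of_tuple @^-1` A).
Proof.
move=> [B mB <-]; rewrite setTI -comp_preimage.
by rewrite (_ : _ \o _ = id) ?preimage_id//; apply/funext; exact: rV_of_tupleK.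
Qed.

Let lebesgue_borel_rV0 : lebesgue_borel_rV set0 = 0%E.
Proof. by rewrite /lebesgue_borel_rV /pushforward preimage_set0 measure0. Qed.

Let lebesgue_borel_rV_ge0 A : (0 <= lebesgue_borel_rV A)%E.
Proof. exact: (measure_ge0 (lebesgue_tuple R n)). Qed.

Let lebesgue_borel_rV_sigma_additive : semi_sigma_additive lebesgue_borel_rV.
Proof.
move=> F mF tF mUF; rewrite /lebesgue_borel_rV /pushforward preimage_bigcup.
apply: measure_semi_sigma_additive.
- by move=> k; exact: mpre.
- apply/trivIsetP => /= i j _ _ ij; rewrite -preimage_setI.
  by move/trivIsetP : tF => /(_ _ _ _ _ ij) ->//; rewrite preimage_set0.
- by rewrite -preimage_bigcup; exact: mpre.
Qed.

HB.instance Definition _ := isMeasure.Build _ _ _ lebesgue_borel_rV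
  lebesgue_borel_rV0 lebesgue_borel_rV_ge0 lebesgue_borel_rV_sigma_additive.

(* The type ['rV[R]_n] with the sigma-algebra of Lebesgue measurable sets. *)
Definition lebesgueType := caratheodory_type (lebesgue_borel_rV^*)%mu.
HB.instance Definition _ := Measurable.on lebesgueType.

Definition lebesgue_rV : set lebesgueType -> \bar R :=
  @completed_measure_extension _ borel_rV R lebesgue_borel_rV.
HB.instance Definition _ := Measure.on lebesgue_rV.

End lebesgue_rV.
Arguments lebesgue_rV {R n}.

Section euclidean.
Variables (R : realType) (n : nat).
Implicit Types (x z c : 'rV[R]_n) (Q : set 'rV[R]_n) (l : R).

(* The library norm on ['rV[R]_n] is the max norm. *)
Definition enorm x : R := Num.sqrt (\sum_i x ord0 i ^+ 2).

(* The filter of [z --> oo], that is, [enorm z --> +oo]. *)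
Definition einfty : set_system 'rV[R]_n :=
  filter_from setT (fun M : R => [set z | M < enorm z]).

#[global] Instance einfty_filter : Filter einfty.
Proof.
apply: filter_from_filter; first by exists 0.
move=> M N _ _; exists (Num.max M N) => // z /=.
by rewrite gt_max => /andP[].
Qed.

(* The closed cube with lower corner [c] and edges of length [l] parallel to
   the coordinate axes. *)
Definition cube c l : set 'rV[R]_n :=
  [set x | forall i, c ord0 i <= x ord0 i <= c ord0 i + l].

Definition is_cube l Q := 0 < l /\ exists c, Q = cube c l.

Definition translate Q z : set 'rV[R]_n := [set x + z | x in Q].

End euclidean.
Arguments einfty {R n}.

Section volume.
Variable R : realType.
Let T := measurableTypeR R.

Lemma measurable_tuple_box n (A : 'I_n -> set T) :
  (forall i, measurable (A i)) ->
  measurable [set t : n.-tuple T | forall i, A i (tnth t i)].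
Proof.
move=> mA.
rewrite (_ : mkset _ = \bigcap_(i in setT) ((@tnth n T)^~ i @^-1` A i)); last first.
  by apply/seteqP; split => [t tA i _|t tA i]; [exact: tA|exact: (tA i I)].
apply: fin_bigcap_measurable => // i _.
by rewrite -[X in measurable X]setTI; exact: measurable_tnth.
Qed.

Lemma lebesgue_tuple_box n (A : 'I_n -> set T) :
  (forall i, measurable (A i)) ->
  lebesgue_tuple R n [set t | forall i, A i (tnth t i)] =
  (\prod_(i < n) lebesgue_measure (A i))%E.
Proof.
elim: n A => [|n IH] A mA.
  by rewrite big_ord0/= diracE mem_set// => -[].
rewrite big_ord_recl /= -IH => [|i]; last exact: mA.
rewrite -[RHS]product_measure1E//; last first.
  by apply: (@measurable_tuple_box n (fun i => A (lift ord0 i))) => i; exact: mA.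
rewrite /lebesgue_tuple_step /pushforward; congr product_measure1.
apply/seteqP; split => -[x t] /=.
  move=> tA; split => [|i]; first exact: (tA ord0).
  by have := tA (lift ord0 i); rewrite tnthS.
move=> [xA tA] i; case: (unliftP ord0 i) => [j|] ->; rewrite ?tnthS//.
Qed.

Lemma lebesgue_cube n (c : 'rV[R]_n) (l : R) : 0 <= l ->
  lebesgue_rV (cube c l) = (l ^+ n)%:E.
Proof.
move=> l0; pose A i : set T := `[c ord0 i, c ord0 i + l]%classic.
have mA i : measurable (A i) by exact: measurable_itv.
have cA : cube c l =
    @tuple_of_rV R n @^-1` [set t | forall i, A i (tnth t i)].
  by apply/seteqP; split => x /= xA i; have := xA i;
    rewrite tnth_mktuple /A /= in_itv.
have mcube : measurable (cube c l : set (borel_rV R n)).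
  rewrite cA; exists [set t | forall i, A i (tnth t i)]; rewrite ?setTI//.
  exact: measurable_tuple_box.
rewrite /lebesgue_rV /completed_measure_extension measurable_mu_extE//.
rewrite /lebesgue_borel_rV /pushforward cA.
rewrite [X in lebesgue_tuple R n X = _](_ : _ = [set t | forall i, A i (tnth t i)]); last first.
  by apply/funext => t; rewrite /preimage /= rV_of_tupleK.
rewrite lebesgue_tuple_box//.
rewrite (eq_bigr (fun=> l%:E)); last first.
  move=> i _; rewrite /A lebesgue_measure_itv/= lte_fin ltrDl.
  case: ltgtP l0 => // [_|<-] _; first by rewrite -EFinB addrC addKr.
  by [].
by rewrite prodEFin prodr_const card_ord.
Qed.
End volume.

Section campanato.
Variables (R : realType) (n : nat).
Implicit Types (f g : 'rV[R]_n -> R) (Q : set 'rV[R]_n) (alpha : R).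

Local Notation mu := (@lebesgue_rV R n).

Definition locally_integrable_rV f :=
  measurable_fun setT (f : lebesgueType R n -> R) /\
  forall K, compact K -> (\int[mu]_(x in K) `|f x|%:E < +oo)%E.

Definition average f Q : R := (fine (mu Q))^-1 * \int[mu]_(x in Q) f x.

Definition osc alpha f Q : \bar R :=
  ((fine (mu Q) `^ (- 1 - alpha / n%:R))%:E *
   \int[mu]_(x in Q) `|f x - average f Q|%:E)%E.

Definition sup_osc alpha f (P : set R) : \bar R :=
  ereal_sup [set osc alpha f Q | Q in [set Q | exists2 l, P l & is_cube l Q]].

Definition BMO alpha f :=
  locally_integrable_rV f /\ (sup_osc alpha f setT < +oo)%E.

Definition VMO alpha f := BMO alpha f /\
  sup_osc alpha f [set l | l <= a] @[a --> 0^'+] --> 0%E.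

Definition XMO alpha f := VMO alpha f /\
  forall l Q, is_cube l Q ->
    osc alpha f (translate Q z) @[z --> einfty] --> 0%E.

Definition CMO alpha f := XMO alpha f /\
  sup_osc alpha f [set l | a <= l] @[a --> +oo] --> 0%E.

Definition continuous_representative f g :=
  continuous g /\ f = g %[ae mu].

Definition sup_holder alpha g (D : set ('rV[R]_n * 'rV[R]_n)) : \bar R :=
  ereal_sup [set (`|g p.1 - g p.2| / enorm (p.1 - p.2) `^ alpha)%:E | p in D].

End campanato.

(* Main.v *)
(* The Campanato argument. The averages of f over the images Q_j of a cube Q
   under the homotheties of ratio 2^-j centered at a point x of Q satisfy
   |<f>_{Q_(j+1)} - <f>_{Q_j}| <= 2^n l(Q_j)^alpha O_alpha(f; Q_j), so they
   converge geometrically to a number g(x) that does not depend on Q, with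
   |g(x) - <f>_Q| <= C l(Q)^alpha sup_j O_alpha(f; Q_j). Applied to the cube of
   edge |x - y| spanned by x and y, this bounds |g(x) - g(y)| by oscillations
   over subcubes only, whence the three pointwise conditions. That f = g almost
   everywhere needs no differentiation theorem: the integral of |f - g| over Q
   is at most K l(Q)^(n+alpha), and cutting Q into 2^n halves improves this
   bound by the factor 2^-alpha, any number of times. The converse implications
   bound the oscillation over Q by the distance from g to its value at the lower
   corner of Q. *)
Require Import Defs.
From mathcomp Require Import all_boot all_order all_algebra.
From mathcomp Require Import all_classical all_reals all_analysis.
From mathcomp Require Import ring lra.

Set Implicit Arguments.
Unset Strict Implicit.
Unset Printing Implicit Defensive.

Import Order.TTheory GRing.Theory Num.Theory.
Import numFieldNormedType.Exports measurable_realfun.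

Local Open Scope classical_set_scope.
Local Open Scope ring_scope.

(** * Measurability and compactness of cubes, measurability of continuous functions *)

Section cubes.
Variables (R : realType) (n : nat).
Implicit Types (f g : 'rV[R]_n -> R) (c x y z : 'rV[R]_n) (l t : R).
Local Notation mu := (@lebesgue_rV R n).

Lemma measurable_cube c l : measurable (cube c l : set (lebesgueType R n)).
Proof.
apply: sub_caratheodory; apply: sub_sigma_algebra.
pose A i : set (measurableTypeR R) := `[c ord0 i, c ord0 i + l]%classic.
exists [set t | forall i, A i (tnth t i)].
  by apply: measurable_tuple_box => i; exact: measurable_itv.
rewrite setTI; apply/seteqP; split => x /= xA i; have := xA i;
  by rewrite tnth_mktuple /A /= in_itv.
Qed.

Lemma compact_cube c l : compact (cube c l).
Proof.
pose A i : set R := `[c ord0 i, c ord0 i + l]%classic.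
rewrite [X in compact X](_ : _ = [set v : 'rV[R]_n | forall i, A i (v ord0 i)]).
  by apply: rV_compact => i; exact: segment_compact.
by apply/seteqP; split => x /= xA i; have := xA i; rewrite /A /= in_itv.
Qed.

(** An open set is the union of the countably many closed cubes with rational lower corner and edge
    $1/(k+1)$ that it contains. *)
Lemma open_measurable_rV (U : set 'rV[R]_n) :
  open U -> measurable (U : set (lebesgueType R n)).
Proof.
move=> oU.
pose C (p : {ffun 'I_n -> rat} * nat) : set 'rV[R]_n :=
  cube (\row_i ratr (p.1 i)) p.2.+1%:R^-1.
pose F p : set 'rV[R]_n := if `[< C p `<=` U >] then C p else set0.
rewrite (_ : U = \bigcup_p F p); last first.
  apply/seteqP; split => [x Ux|x [p _]]; last first.
    by rewrite /F; case: ifPn => // /asboolP; exact.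
  have /nbhs_ballP[e /= e0 xeU] : nbhs x U by exact: open_nbhs_nbhs.
  have [k ke] : exists k : nat, k.+1%:R^-1 < e.
    have [k _ /(_ k (leqnn k))] := near_infty_natSinv_lt (PosNum e0).
    by exists k.
  (* In each coordinate the corner lies below [x] by less than one edge, so the cube contains [x];
     its points are within $1/(k+1) < e$ of [x] in the max norm. *)
  have q_ i : {q : rat | x ord0 i - k.+1%:R^-1 < ratr q < x ord0 i}.
    have xk : x ord0 i - k.+1%:R^-1 < x ord0 i by rewrite ltrBlDr ltrDl.
    by apply: cid; have [q] := rat_in_itvoo xk; rewrite in_itv; exists q.
  pose p := ([ffun i => sval (q_ i)], k).
  have qE i : (\row_i ratr (p.1 i) : 'rV[R]_n) ord0 i = ratr (sval (q_ i)).
    by rewrite mxE ffunE.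
  exists p => //; rewrite /F ifT.
    move=> i; rewrite qE -[p.2]/k.
    case: (q_ i) => q /= /andP[]; move: (k.+1%:R^-1) => d ? ?.
    by apply/andP; split; lra.
  apply/asboolP => y Cy; apply: xeU; split=> // a i; rewrite (ord1 a){a}.
  have := Cy i; rewrite qE -[p.2]/k.
  rewrite /ball/= ltr_norml; move: ke; case: (q_ i) => q /= /andP[].
  move: (k.+1%:R^-1) => d ? ? ? /andP[? ?].
  by apply/andP; split; lra.
apply: countable_bigcupT_measurable => [|p]; first exact: countableP.
by rewrite /F; case: ifPn => _ //; exact: measurable_cube.
Qed.

Lemma continuous_measurable_rV g :
  continuous g -> measurable_fun setT (g : lebesgueType R n -> R).
Proof.
move=> /continuousP cg.
apply: (measurability _ (RGenOInfty.measurableE R)) => _ [_ [x ->] <-].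
rewrite setTI; apply: open_measurable_rV; apply: cg.
exact: interval_open.
Qed.

End cubes.

(** * Deviation of a function from a constant over a cube *)

Section deviation.
Variables (R : realType) (n : nat).
Implicit Types (g : 'rV[R]_n -> R) (c x y z : 'rV[R]_n) (l t d : R).
Local Notation mu := (@lebesgue_rV R n).

(** Unlike [osc], it is real-valued, not normalised and not tied to the average, so cubes of
    different sizes and different constants can be compared before dividing by a power of the
    edge. *)
Definition dev (f : 'rV[R]_n -> R) d (Q : set 'rV[R]_n) : R :=
  \int[mu]_(x in Q) `|f x - d|.

Lemma integrable_cst_cube c l d :
  0 < l -> mu.-integrable (cube c l) (EFin \o cst d).
Proof.
move=> l0; apply: measurable_bounded_integrable => //.
- exact: measurable_cube.
- by rewrite [ltLHS]lebesgue_cube ?ltW// ltry.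
- exists `|d|; split; first exact: num_real.
  by move=> M dM x _; rewrite /= ltW.
Qed.

Variable f : 'rV[R]_n -> R.
Hypothesis lif : locally_integrable_rV f.

Lemma integrable_cube c l : mu.-integrable (cube c l) (EFin \o f).
Proof.
case: lif => mf fi; apply/integrableP; split.
  apply/measurable_EFinP; apply: measurable_funTS; exact: mf.
by apply: fi; exact: compact_cube.
Qed.

Lemma integrable_subr_cube c l d : 0 < l ->
  mu.-integrable (cube c l) (EFin \o (fun x => f x - d)).
Proof.
move=> l0; rewrite (_ : _ \o _ = (EFin \o f) \- (EFin \o cst d))%E //.
apply: integrableB; first exact: measurable_cube.
  exact: integrable_cube.
exact: integrable_cst_cube.
Qed.

Lemma integrable_dist_cube c l d : 0 < l ->
  mu.-integrable (cube c l) (EFin \o (fun x => `|f x - d|)).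
Proof. by move=> l0; exact: integrable_norm (integrable_subr_cube _ _ l0). Qed.

Lemma dev_ge0 d Q : 0 <= dev f d Q.
Proof. by apply: Rintegral_ge0 => x _. Qed.

Lemma EFin_dev d c l : 0 < l ->
  (dev f d (cube c l))%:E = (\int[mu]_(x in cube c l) `|f x - d|%:E)%E.
Proof.
move=> l0; rewrite /dev /Rintegral fineK//.
apply: integrable_fin_num; first exact: measurable_cube.
exact: integrable_dist_cube.
Qed.

Lemma measurable_dist d c l :
  measurable_fun (cube c l : set (lebesgueType R n)) (fun x => `|f x - d|%:E).
Proof.
apply/measurable_EFinP; apply: measurableT_comp; first exact: normr_measurable.
apply: measurable_funB; last exact: measurable_cst.
by apply: measurable_funTS; exact: (proj1 lif).
Qed.

Lemma subset_dev d c l c' l' : 0 < l -> 0 < l' -> cube c' l' `<=` cube c l ->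
  dev f d (cube c' l') <= dev f d (cube c l).
Proof.
move=> l0 l'0 cc; rewrite -lee_fin !EFin_dev//.
apply: ge0_subset_integral; [exact: measurable_cube|exact: measurable_cube|
  exact: measurable_dist|by move=> x _; rewrite lee_fin|exact: cc].
Qed.

Lemma average_dev c l d : 0 < l ->
  `|average f (cube c l) - d| <= (l ^+ n)^-1 * dev f d (cube c l).
Proof.
move=> l0; have ln0 : 0 < l ^+ n by exact: exprn_gt0.
have muE : fine (mu (cube c l)) = l ^+ n by rewrite lebesgue_cube// ltW.
rewrite /average muE.
have -> : (l ^+ n)^-1 * \int[mu]_(x in cube c l) f x - d =
    (l ^+ n)^-1 * \int[mu]_(x in cube c l) (f x - d).
  rewrite RintegralB//; last 3 first.
  - exact: measurable_cube.
  - exact: integrable_cube.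
  - exact: integrable_cst_cube.
  rewrite Rintegral_cst//; last exact: measurable_cube.
  by rewrite muE mulrBr mulrCA mulVf ?mulr1// gt_eqF.
rewrite normrM gtr0_norm ?invr_gt0// ler_pM2l ?invr_gt0//.
apply: le_normr_Rintegral; first exact: measurable_cube.
exact: integrable_subr_cube.
Qed.

Lemma dev_shift c l d d' : 0 < l ->
  dev f d' (cube c l) <= dev f d (cube c l) + l ^+ n * `|d - d'|.
Proof.
move=> l0; have muE : fine (mu (cube c l)) = l ^+ n.
  by rewrite lebesgue_cube// ltW.
have -> : l ^+ n * `|d - d'| = \int[mu]_(x in cube c l) cst `|d - d'| x.
  by rewrite Rintegral_cst ?muE 1?mulrC//; exact: measurable_cube.
rewrite -RintegralD//; last 3 first.
- exact: measurable_cube.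
- exact: integrable_dist_cube.
- exact: integrable_cst_cube.
apply: le_Rintegral; first exact: measurable_cube.
- exact: integrable_dist_cube.
- rewrite (_ : _ \o _ = (EFin \o (fun x => `|f x - d|)%R) \+
    (EFin \o cst `|d - d'|%R))%E //.
  apply: integrableD; first exact: measurable_cube.
    exact: integrable_dist_cube.
  exact: integrable_cst_cube.
- move=> x _ /=; have -> : f x - d' = (f x - d) + (d - d') by ring.
  exact: ler_normD.
Qed.

(** The average differs from [d] by at most the mean deviation from [d], so moving the constant from
    [d] to the average at most doubles the deviation. *)
Lemma dev_average c l d : 0 < l ->
  dev f (average f (cube c l)) (cube c l) <= 2 * dev f d (cube c l).
Proof.
move=> l0; have ln0 : 0 < l ^+ n by exact: exprn_gt0.
apply: (le_trans (dev_shift _ d _ l0)).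
rewrite mulr_natl mulr2n lerD2l distrC.
by rewrite -ler_pdivlMl//; exact: average_dev.
Qed.

Lemma dev_ae_le g d c l M : 0 < l -> f = g %[ae mu] ->
  (forall x, cube c l x -> `|g x - d| <= M) ->
  dev f d (cube c l) <= l ^+ n * M.
Proof.
move=> l0 fg gM.
have M0 : 0 <= M.
  apply: (le_trans (normr_ge0 (g c - d))); apply: gM => i.
  by rewrite lexx/= lerDl ltW.
rewrite -lee_fin EFin_dev//.
rewrite (_ : (l ^+ n * M)%:E =
  \int[mu]_(x in cube c l) (cst M%:E) x)%E; last first.
  rewrite integral_cst; last exact: measurable_cube.
  by rewrite [X in (_ * X)%E]lebesgue_cube ?ltW// EFinM muleC.
apply: ae_ge0_le_integral; first exact: measurable_cube.
- by move=> x _; rewrite lee_fin.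
- exact: measurable_dist.
- by move=> x _; rewrite lee_fin.
- exact: measurable_cst.
- apply: (@filterS _ _ (ae_filter_ringOfSetsType mu)) fg => x /= fgx cx.
  by rewrite fgx// lee_fin gM.
Qed.

End deviation.

(** * Limits with geometric error terms *)

Section geometric.
Variables (R : realType) (r : R).
Hypotheses (r_ge0 : 0 <= r) (r_lt1 : r < 1).

Lemma geometric_lt (K e : R) : 0 < e -> exists k, K * r ^+ k < e.
Proof.
move=> e0; have /cvgr0Pnorm_lt/(_ _ e0)[k _ /(_ k (leqnn k))] :=
  @cvg_geometric R K r ltac:(by rewrite ger0_norm).
by move=> /(le_lt_trans (ler_norm _)) ke; exists k.
Qed.

(** The passage to the limit in the Campanato estimates, whose error terms decay like $r^k$. *)
Lemma le_geometric (a b K : R) : (forall k, a <= b + K * r ^+ k) -> a <= b.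
Proof.
move=> ab; apply/ler_addgt0Pr => e /(geometric_lt K)[k ke].
by apply: (le_trans (ab k)); rewrite lerD2l ltW.
Qed.

(** The hypothesis compares [u j] with every later term, so the sequence is Cauchy and the limit
    inherits the constant [K] unchanged. *)
Lemma geometric_cvg (u : R^nat) (K : R) :
  (forall j m, `|u j - u (j + m)%N| <= K * r ^+ j) ->
  exists v, forall j, `|u j - v| <= K * r ^+ j.
Proof.
move=> uK; have cu : cvg (u @ \oo).
  apply: cauchy_cvg; apply: cauchy_exP => e /(geometric_lt K)[k ke].
  exists (u k); exists k => // m /= km; rewrite /ball/=.
  by rewrite -(subnKC km); exact: le_lt_trans ke.
exists (lim (u @ \oo)) => j; apply/ler_addgt0Pr => e e0.
have /cvgrPdist_lt/(_ _ e0)[k _ /(_ (j + k)%N (leq_addl _ _))/= ku] := cu.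
rewrite (_ : u j - _ = (u j - u (j + k)%N) - (lim (u @ \oo) - u (j + k)%N)).
  by apply: (le_trans (ler_normB _ _)); apply: lerD => //; exact: ltW.
by ring.
Qed.

End geometric.

(** * Powers of one half and the ratio $2^{-\alpha}$ *)

Section half.
Variables (R : realType) (alpha : R).
Hypothesis alpha_gt0 : 0 < alpha.

Lemma half_exp_gt0 j : 0 < 2^-1 ^+ j :> R.
Proof. by rewrite exprn_gt0// invr_gt0. Qed.

Lemma half_powR_ge0 : 0 <= 2^-1 `^ alpha.
Proof. exact: powR_ge0. Qed.

Lemma half_powR_lt1 : 2^-1 `^ alpha < 1.
Proof.
have : 2^-1 `^ alpha < 1 `^ alpha :> R by
  rewrite gt0_ltr_powR// ?nnegrE ?invr_ge0// invf_lt1// ltr1n.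
by rewrite powR1.
Qed.

Lemma half_exp_powR j : (2^-1 ^+ j) `^ alpha = (2^-1 `^ alpha) ^+ j.
Proof.
elim: j => [|j IH]; first by rewrite !expr0 powR1.
by rewrite !exprS powRM ?IH ?exprn_ge0 ?invr_ge0.
Qed.

End half.

(** * Homothetic images of cubes *)

Section homothety.
Variables (R : realType) (n : nat).
Implicit Types (c x y z : 'rV[R]_n) (l t s : R).

(* The image of [cube c l] under the homothety of center [x] and ratio [t]. *)
Definition hcube x c l t : set 'rV[R]_n := cube (x + t *: (c - x)) (t * l).

Lemma hcube1 x c l : hcube x c l 1 = cube c l.
Proof. by rewrite /hcube scale1r mul1r addrC subrK. Qed.

(** Homotheties with the same center compose, so the tail of a chain of homothetic cubes is again
    such a chain. *)
Lemma hcubeM x c l s t :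
  hcube x (x + s *: (c - x)) (s * l) t = hcube x c l (s * t).
Proof. by rewrite /hcube addrAC subrr add0r scalerA mulrA [t * s]mulrC. Qed.

Lemma hcube_center x c l t : 0 <= t -> cube c l x -> hcube x c l t x.
Proof.
move=> t0 cx i; have := cx i; rewrite !mxE => /andP[cx1 cx2].
by apply/andP; split; nra.
Qed.

Lemma subset_cube c l c' l' :
  (forall i, c ord0 i <= c' ord0 i /\ c' ord0 i + l' <= c ord0 i + l) ->
  cube c' l' `<=` cube c l.
Proof.
move=> cc x c'x i; have [h1 h2] := cc i; have /andP[h3 h4] := c'x i.
by apply/andP; split; lra.
Qed.

(** As the center satisfies $c_i \le x_i \le c_i + l$, the lower faces $x_i + t(c_i - x_i)$ decrease
    and the upper faces $x_i + t(c_i + l - x_i)$ increase with $t$. *)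
Lemma subset_hcube x c l s t : cube c l x -> s <= t ->
  hcube x c l s `<=` hcube x c l t.
Proof.
move=> cx st; apply: subset_cube => i; have /andP[h1 h2] := cx i.
by rewrite !mxE; split; nra.
Qed.

(** The cube of edge [l + 1] is a common enlargement of [cube c l] and of the unit cube with lower
    corner [x]. Comparing both chains with its chain makes the limit of the averages independent of
    the cube. *)
Lemma subset_hcubeD1 x c l t : cube c l x -> 0 <= t ->
  hcube x c l t `<=` hcube x c (l + 1) t /\
  hcube x x 1 t `<=` hcube x c (l + 1) t.
Proof.
move=> cx t0; split; apply: subset_cube => i; have /andP[h1 h2] := cx i;
  by rewrite !mxE; split; nra.
Qed.

End homothety.

(** * Averages and oscillations over nested cubes *)

Section chain.
Variables (R : realType) (n : nat) (alpha : R) (f : 'rV[R]_n -> R).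
Hypotheses (n_gt0 : (0 < n)%N) (alpha_gt0 : 0 < alpha).
Hypothesis lif : locally_integrable_rV f.
Implicit Types (c x y z : 'rV[R]_n) (l t s E : R).

(** Since $|Q| = l^n$ with $n \ne 0$, the weight $|Q|^{-1-\alpha/n}$ is $l^{-n-\alpha}$. *)
Lemma osc_cube c l : 0 < l -> osc alpha f (cube c l) =
  ((l ^+ n * l `^ alpha)^-1 * dev f (average f (cube c l)) (cube c l))%:E.
Proof.
move=> l0; rewrite /osc -EFin_dev// -EFinM lebesgue_cube ?ltW//=.
congr (_ * _)%:E; rewrite -powR_mulrn ?ltW// -powRrM.
rewrite mulrBr mulrN1 mulrCA mulfV ?mulr1 ?pnatr_eq0 -?lt0n//.
by rewrite -opprD powRN powRD// (gt_eqF l0) implybT.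
Qed.

Lemma osc_le c l E : 0 < l -> (osc alpha f (cube c l) <= E%:E)%E =
  (dev f (average f (cube c l)) (cube c l) <= l ^+ n * (l `^ alpha * E)).
Proof.
move=> l0; rewrite osc_cube// lee_fin mulrA ler_pdivrMl//.
by rewrite mulr_gt0 ?exprn_gt0 ?powR_gt0.
Qed.

Lemma osc_ge0 c l : 0 < l -> (0 <= osc alpha f (cube c l))%E.
Proof.
move=> l0; rewrite osc_cube// lee_fin mulr_ge0 ?dev_ge0//.
by rewrite invr_ge0 mulr_ge0 ?exprn_ge0 ?powR_ge0 ?ltW.
Qed.

(** The deviation over the small cube from the average of the large one is at most that over the
    large cube; averaging over the small cube then costs the ratio of the volumes. *)
Lemma average_subset c l c' l' E : 0 < l -> 0 < l' ->
  cube c' l' `<=` cube c l -> (osc alpha f (cube c l) <= E%:E)%E ->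
  `|average f (cube c' l') - average f (cube c l)| <=
    (l / l') ^+ n * (l `^ alpha * E).
Proof.
move=> l0 l'0 cc oE; rewrite (osc_le c _ l0) in oE.
apply: (le_trans (average_dev lif _ _ l'0)).
rewrite mulrC ler_pdivrMr ?exprn_gt0// mulrAC -exprMn divfK ?gt_eqF//.
by apply: le_trans oE; exact: subset_dev.
Qed.

(** The factor 2 comes from the change of average and the powers of [l / l'] from the two
    normalisations, so the loss is bounded as long as the edges stay comparable. *)
Lemma osc_subset c l c' l' E : 0 < l -> 0 < l' ->
  cube c' l' `<=` cube c l -> (osc alpha f (cube c l) <= E%:E)%E ->
  (osc alpha f (cube c' l') <=
     (2 * (l / l') ^+ n * (l / l') `^ alpha * E)%:E)%E.
Proof.
move=> l0 l'0 cc oE; rewrite (osc_le c' _ l'0); rewrite (osc_le c _ l0) in oE.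
apply: (le_trans (dev_average lif _ (average f (cube c l)) l'0)).
have -> : l' ^+ n * (l' `^ alpha * (2 * (l / l') ^+ n * (l / l') `^ alpha * E))
  = 2 * ((l / l' * l') ^+ n * ((l / l') `^ alpha * l' `^ alpha * E)).
  move: (l / l') => q; rewrite exprMn.
  move: (q ^+ n) (l' ^+ n) (q `^ alpha) (l' `^ alpha) => a b a' b'.
  by ring.
rewrite -powRM ?divfK ?(gt_eqF l'0) ?(ltW l'0) ?(ltW (divr_gt0 l0 l'0))//.
rewrite ler_pM2l//.
by apply: le_trans oE; exact: subset_dev.
Qed.

(** The sum of the series $\sum_j 2^n r^j$ with $r = 2^{-\alpha}$, where $2^n$ is the ratio of the
    volumes of consecutive cubes in a chain. *)
Definition campanato_const : R := 2 ^+ n / (1 - 2^-1 `^ alpha).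
Local Notation C := campanato_const.
Local Notation r := (2^-1 `^ alpha).
Let r_lt1 : r < 1. Proof. exact: half_powR_lt1. Qed.
Let r_ge0 : 0 <= r. Proof. exact: half_powR_ge0. Qed.

Lemma campanato_const_ge0 : 0 <= C.
Proof. by rewrite divr_ge0 ?exprn_ge0// subr_ge0 ltW. Qed.

Let av x c l j := average f (hcube x c l (2^-1 ^+ j)).

Lemma average_chain x c l E k : 0 < l -> cube c l x -> 0 <= E ->
  (forall j, (j < k)%N ->
    (osc alpha f (hcube x c l (2^-1 ^+ j)) <= E%:E)%E) ->
  `|average f (hcube x c l (2^-1 ^+ k)) - average f (cube c l)| <=
    C * (l `^ alpha * E).
Proof.
move=> l0 cx E0 oE; rewrite -(hcube1 x).
(* The induction runs on the partial sums of that series: the factor $1 - r^k$ grows at each step by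
   $r^k(1 - r)$, which matches the bound $2^n r^k l^\alpha E$ on one link of the chain. *)
suff H : `|av x c l k - average f (hcube x c l 1)| <=
    C * (l `^ alpha * E) * (1 - r ^+ k).
  apply: (le_trans H); rewrite ler_piMr//.
  exact: (mulr_ge0 campanato_const_ge0 (mulr_ge0 (powR_ge0 _ _) E0)).
elim: k oE => [_|k IH oE].
  by rewrite /av !expr0 !subrr normr0 mulr0.
have {}IH := IH (fun j jk => oE j (ltnW jk)).
rewrite -(subrKA (av x c l k)) addrC.
apply: (le_trans (ler_normD _ _)).
have step : `|av x c l k.+1 - av x c l k| <=
    C * (l `^ alpha * E) * (r ^+ k * (1 - r)).
  apply: le_trans (average_subset _ _ _ (oE k (ltnSn k))) _.
  - by rewrite mulr_gt0.
  - by rewrite mulr_gt0.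
  - apply: subset_hcube => //; rewrite exprS.
    by rewrite ler_piMl ?(ltW (half_exp_gt0 _ _))// invf_le1 ?ler1n.
  rewrite exprS powRM ?(ltW (half_exp_gt0 _ _)) ?(ltW l0)// half_exp_powR.
  rewrite (_ : _ / _ = 2); last first.
    have h := half_exp_gt0 R k; field.
    by rewrite !gt_eqF.
  have CE : C * (1 - r) = 2 ^+ n by rewrite divfK// subr_eq0 gt_eqF.
  rewrite le_eqVlt; apply/orP; left; apply/eqP; rewrite -CE.
  by move: (r ^+ k) (l `^ alpha) (r) C => a b r' C'; ring.
apply: (le_trans (lerD IH step)); rewrite exprS le_eqVlt.
by apply/orP; left; apply/eqP; move: (r ^+ k) (r) C => a r' C'; ring.
Qed.

End chain.

(** * The pointwise limit of the averages *)

Section representative.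
Variables (R : realType) (n : nat) (alpha : R) (f : 'rV[R]_n -> R).
Hypotheses (n_gt0 : (0 < n)%N) (alpha_gt0 : 0 < alpha).
Hypothesis lif : locally_integrable_rV f.
Variable B : R.
Hypothesis B_ge0 : 0 <= B.
Hypothesis oscB : forall c l, 0 < l -> (osc alpha f (cube c l) <= B%:E)%E.
Implicit Types (c x y z : 'rV[R]_n) (l t s E : R).

Local Notation C := (campanato_const n alpha).
Local Notation r := (2^-1 `^ alpha).

Let r_ge0 : 0 <= r. Proof. exact: half_powR_ge0. Qed.
Let r_lt1 : r < 1. Proof. exact: half_powR_lt1. Qed.
Let C_ge0 : 0 <= C. Proof. exact: campanato_const_ge0. Qed.

(** A chain of [m] links that starts from the [j]-th cube; its edge $2^{-j} l$ provides the factor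
    $r^j$. *)
Lemma average_hcubeD x c l j m : 0 < l -> cube c l x ->
  `|average f (hcube x c l (2^-1 ^+ j)) -
    average f (hcube x c l (2^-1 ^+ (j + m)))| <=
  C * (l `^ alpha * B) * r ^+ j.
Proof.
move=> l0 cx; have hj := half_exp_gt0 R j.
rewrite distrC exprD -hcubeM.
have := @average_chain R n alpha f n_gt0 alpha_gt0 lif x
  (x + 2^-1 ^+ j *: (c - x)) (2^-1 ^+ j * l) B m.
move=> /(_ (mulr_gt0 hj l0) (hcube_center (ltW hj) cx) B_ge0).
rewrite powRM ?(ltW hj) ?(ltW l0)// half_exp_powR => H.
apply: (le_trans (H _)) => [i _|]; last first.
  rewrite le_eqVlt; apply/orP; left; apply/eqP.
  by move: (l `^ alpha) (r ^+ j) C => a b C'; ring.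
by apply: oscB; rewrite mulr_gt0// ?half_exp_gt0// mulr_gt0.
Qed.

Lemma campanato_pointwise : exists g : 'rV[R]_n -> R, forall x c l,
  0 < l -> cube c l x -> `|g x - average f (cube c l)| <= C * (l `^ alpha * B).
Proof.
have xx1 x : cube x 1 x by move=> i; rewrite lexx lerDl ler01.
(* The value at [x] is the limit of the averages over the cubes of edge $2^{-j}$ with lower corner
   [x]. *)
have /choice[g gE] x : exists v, forall j,
    `|average f (hcube x x 1 (2^-1 ^+ j)) - v| <= C * (1 `^ alpha * B) * r ^+ j.
  apply: geometric_cvg => // j m.
  by apply: average_hcubeD => //; exact: xx1.
(* [D] adds the volume ratios of the common enlargement to the two cubes. The error $K r^k$ covers
   the way from [g x] to the average over the [k]-th image of [cube c l], through the unit chain and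
   the enlarged chain. *)
exists g => x c l l0 cx; pose D := ((l + 1) / l) ^+ n + (l + 1) ^+ n.
pose K := C * (1 `^ alpha * B) + D * ((l + 1) `^ alpha * B).
apply: (@le_geometric _ r _ _ _ _ K) => // k.
have h0 := half_exp_gt0 R k.
have l10 : 0 < l + 1 by rewrite addr_gt0.
have [s1 s2] := subset_hcubeD1 cx (ltW h0).
have hl0 := mulr_gt0 h0 l10.
have H2 := average_subset n_gt0 lif hl0 (mulr_gt0 h0 l0) s1 (oscB _ hl0).
have H3 := average_subset n_gt0 lif hl0 (mulr_gt0 h0 ltr01) s2 (oscB _ hl0).
have H4 : `|average f (hcube x c l (2^-1 ^+ k)) - average f (cube c l)| <=
  C * (l `^ alpha * B).
  apply: average_chain => // j _; apply: oscB.
  by rewrite mulr_gt0// half_exp_gt0.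
have H1 := gE x k.
move: H2 H3; rewrite -/(hcube x c l _) -/(hcube x x 1 _) -/(hcube x c (l+1) _).
rewrite (_ : _ / (_ * l) = (l + 1) / l); last by field; rewrite !gt_eqF.
rewrite (_ : _ / (_ * 1) = l + 1); last first.
  by rewrite mulr1 mulrAC divff ?mul1r// gt_eqF.
rewrite powRM ?(ltW h0) ?(ltW l10)// half_exp_powR.
move: H1 H4; rewrite {}/K {}/D.
set a1 := average f (hcube x x 1 _); set a2 := average f (hcube x c l _).
set a3 := average f (hcube x c (l + 1) _); set a0 := average f (cube c l).
move=> H1 H4 H2 H3.
rewrite (_ : g x - a0 = (a2 - a0) + ((a1 - a3) - (a1 - g x) - (a2 - a3)));
  last by ring.
apply: (le_trans (ler_normD _ _)); apply: lerD => //.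
apply: (le_trans (ler_normB _ _)).
apply: (le_trans (lerD (ler_normB _ _) (lexx _))).
apply: (le_trans (lerD (lerD H3 H1) H2)).
rewrite le_eqVlt; apply/orP; left; apply/eqP.
move: (((l + 1) / l) ^+ n) ((l + 1) ^+ n) ((l + 1) `^ alpha) (1 `^ alpha).
move: (r ^+ k) C.
by move=> *; ring.
Qed.

Variable g : 'rV[R]_n -> R.
Hypothesis gP : forall x c l,
  0 < l -> cube c l x -> `|g x - average f (cube c l)| <= C * (l `^ alpha * B).

(** The small bound [E] serves for the first [k] links, and the global bound [B] for everything
    below the [k]-th cube. *)
Lemma campanato_truncated x c l E k : 0 < l -> cube c l x -> 0 <= E ->
  (forall j, (j < k)%N ->
    (osc alpha f (hcube x c l (2^-1 ^+ j)) <= E%:E)%E) ->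
  `|g x - average f (cube c l)| <=
    C * (l `^ alpha * E) + C * ((2^-1 ^+ k * l) `^ alpha * B).
Proof.
move=> l0 cx E0 oE; have h0 := half_exp_gt0 R k.
have H1 := average_chain n_gt0 alpha_gt0 lif l0 cx E0 oE.
have H2 := gP (mulr_gt0 h0 l0) (hcube_center (ltW h0) cx).
rewrite -(subrKA (average f (hcube x c l (2^-1 ^+ k)))) addrC.
by apply: (le_trans (ler_normD _ _)); exact: lerD.
Qed.

Lemma campanato_local x c l E : 0 < l -> cube c l x -> 0 <= E ->
  (forall j, (osc alpha f (hcube x c l (2^-1 ^+ j)) <= E%:E)%E) ->
  `|g x - average f (cube c l)| <= C * (l `^ alpha * E).
Proof.
move=> l0 cx E0 oE.
apply: (@le_geometric _ r _ _ _ _ (C * (l `^ alpha * B))) => // k.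
have := @campanato_truncated x c l E k l0 cx E0 (fun j _ => oE j).
rewrite powRM ?(ltW (half_exp_gt0 R k)) ?(ltW l0)// half_exp_powR => H.
apply: (le_trans H); rewrite lerD2l le_eqVlt; apply/orP; left; apply/eqP.
by move: (l `^ alpha) (r ^+ k) C => a b C'; ring.
Qed.

End representative.

(** * Integrals over finite covers *)

Section integral_cover.
Local Open Scope ereal_scope.

(** The pieces may overlap, as half cubes do along their faces; each piece is removed from the union
    of the following ones before additivity is applied. *)
Lemma ge0_integral_cover d (R : realType) (T : measurableType d)
  (m : {measure set T -> \bar R}) (I : eqType) (s : seq I) (F : I -> set T)
  (A : set T) (h : T -> \bar R) :
  measurable A -> (forall i, measurable (F i)) -> measurable_fun setT h ->
  (forall x, 0 <= h x) -> A `<=` \big[setU/set0]_(i <- s) F i ->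
  (\int[m]_(x in A) h x <= \sum_(i <- s) \int[m]_(x in F i) h x).
Proof.
move=> mA mF mh h0 AF.
have mU s' : measurable (\big[setU/set0]_(i <- s') F i).
  by apply: bigsetU_measurable.
apply: (le_trans (@ge0_subset_integral _ _ _ m A _ mA (mU s) h _ _ AF)) => //.
  exact: measurable_funTS.
elim: s {AF} => [|i s IH]; first by rewrite !big_nil integral_set0.
rewrite !big_cons.
rewrite (_ : F i `|` _ = F i `|` ((\big[setU/set0]_(j <- s) F j) `\` F i)).
  rewrite ge0_integral_setU//; last 3 first.
  - exact: measurableD.
  - exact: measurable_funTS.
  - by rewrite /disj_set setIDA setIC -setIDA setDv setI0 eqxx.
  rewrite leeD2l//; apply: le_trans IH; apply: ge0_subset_integral => //.
  - exact: measurableD.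
  - exact: measurable_funTS.
by rewrite setUDr setDv setD0.
Qed.

End integral_cover.

(** * Max norm, Euclidean norm and the cube spanned by two points *)

Section norms.
Variables (R : realType) (n : nat).
Implicit Types (x y : 'rV[R]_n).

Lemma coord_le_norm x i : `|x ord0 i| <= `|x|.
Proof.
rewrite [leRHS]mx_normrE.
exact: (@le_bigmax _ _ _ _ (fun ij => `|x ij.1 ij.2|) (ord0, i)).
Qed.

Lemma enorm_ge0 x : 0 <= enorm x. Proof. exact: sqrtr_ge0. Qed.

Lemma norm_le_enorm x : `|x| <= enorm x.
Proof.
have [->|x0] := eqVneq x 0; first by rewrite normr0 enorm_ge0.
have [[a i] /= xE] : exists i : 'I_1 * 'I_n, `|x| = `|x i.1 i.2|.
  by apply: mx_norm_neq0; move: x0; rewrite -normr_eq0.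
rewrite xE (ord1 a) -sqrtr_sqr ler_sqrt ?sqr_ge0//; last first.
  by apply: sumr_ge0 => j _; exact: sqr_ge0.
by rewrite (bigD1 i)//= lerDl sumr_ge0// => j _; exact: sqr_ge0.
Qed.

(** The crude factor $n$ instead of $\sqrt n$, by $n \le n^2$. *)
Lemma enorm_le_norm x : (0 < n)%N -> enorm x <= n%:R * `|x|.
Proof.
move=> n0; rewrite -[leRHS]ger0_norm ?mulr_ge0// -sqrtr_sqr.
rewrite ler_sqrt ?sqr_ge0//.
apply: (@le_trans _ _ (\sum_(i < n) `|x| ^+ 2)).
  apply: ler_sum => i _; rewrite -real_normK ?num_real//.
  by rewrite ler_pXn2r ?nnegrE// coord_le_norm.
rewrite sumr_const card_ord -[leLHS]mulr_natl exprMn ler_wpM2r ?sqr_ge0//.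
by rewrite -natrX ler_nat -[leqLHS]expn1 leq_pexp2l.
Qed.

Lemma norm_subr_gt0 x y : x != y -> 0 < `|x - y|.
Proof. by rewrite normr_gt0 subr_eq0. Qed.

(** The lower corner of a cube of edge [|x - y|], in the max norm, that contains both points. *)
Definition min_corner x y : 'rV[R]_n := \row_i Num.min (x ord0 i) (y ord0 i).

Lemma min_cornerC x y : min_corner x y = min_corner y x.
Proof. by apply/rowP => i; rewrite !mxE minC. Qed.

Lemma min_corner_cube x y : cube (min_corner x y) `|x - y| x.
Proof.
move=> i; rewrite mxE ge_min lexx/=.
have := coord_le_norm (x - y) i; rewrite !mxE ler_norml => /andP[? ?].
by case: (leP (x ord0 i) (y ord0 i)) => _; [rewrite lerDl|lra].
Qed.

End norms.

(** * Hölder continuity of the limit and its equality with [f] almost everywhere *)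

Section holder.
Variables (R : realType) (n : nat) (alpha : R) (f : 'rV[R]_n -> R).
Hypotheses (n_gt0 : (0 < n)%N) (alpha_gt0 : 0 < alpha).
Hypothesis lif : locally_integrable_rV f.
Variable B : R.
Hypothesis B_ge0 : 0 <= B.
Hypothesis oscB : forall c l, 0 < l -> (osc alpha f (cube c l) <= B%:E)%E.
Implicit Types (c x y z : 'rV[R]_n) (l t s E : R).

Local Notation C := (campanato_const n alpha).
Local Notation r := (2^-1 `^ alpha).
Local Notation mu := (@lebesgue_rV R n).

Variable g : 'rV[R]_n -> R.
Hypothesis gP : forall x c l,
  0 < l -> cube c l x -> `|g x - average f (cube c l)| <= C * (l `^ alpha * B).

Let C_ge0 : 0 <= C. Proof. exact: campanato_const_ge0. Qed.

(** Both values are compared with the average over the spanned cube; the chains centered at its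
    points stay inside it. *)
Lemma holder_local x y E : x != y -> 0 <= E ->
  (forall c l, 0 < l -> cube c l `<=` cube (min_corner x y) `|x - y| ->
    (osc alpha f (cube c l) <= E%:E)%E) ->
  `|g x - g y| <= 2 * (C * (`|x - y| `^ alpha * E)).
Proof.
move=> xy E0 oE; have s0 := norm_subr_gt0 xy.
have cx := min_corner_cube x y.
have cy : cube (min_corner x y) `|x - y| y.
  by rewrite min_cornerC distrC; exact: min_corner_cube.
have key z : cube (min_corner x y) `|x - y| z ->
    `|g z - average f (cube (min_corner x y) `|x - y|)| <=
    C * (`|x - y| `^ alpha * E).
  move=> cz; apply: (campanato_local n_gt0 alpha_gt0 lif gP) => // j.
  apply: oE; first by rewrite mulr_gt0// half_exp_gt0.
  rewrite -[X in _ `<=` X](hcube1 z); apply: subset_hcube => //.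
  by rewrite exprn_ile1 ?invr_ge0 ?invf_le1 ?ler1n.
rewrite -(subrKA (average f (cube (min_corner x y) `|x - y|))).
rewrite mulr_natl mulr2n; apply: (le_trans (ler_normD _ _)).
by apply: lerD; [exact: key|rewrite distrC; exact: key].
Qed.

Lemma campanato_continuous : continuous g.
Proof.
(* The Hölder constant, increased by 1 so that it is positive even when [B] is 0. *)
pose K := 2 * (C * B) + 1.
have CB0 : 0 <= 2 * (C * B) by apply: mulr_ge0 => //; exact: mulr_ge0.
have K0 : 0 < K by rewrite ltr_wpDl.
move=> x; apply/(@cvgrPdist_le _ _ _ (nbhs x) _ g) => /= e e0.
have d0 : 0 < (e / K) `^ alpha^-1 by apply: powR_gt0; exact: divr_gt0.
near=> y; have [->|xy] := eqVneq x y; first by rewrite subrr normr0 ltW.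
have : `|x - y| < (e / K) `^ alpha^-1 by near: y; exact: cvgr_dist_lt.
have s0 := norm_subr_gt0 xy.
move=> /(gt0_ltr_powR alpha_gt0); rewrite !nnegrE (ltW s0) (ltW d0).
move=> /(_ isT isT); rewrite -powRrM mulVf ?gt_eqF// powRr1; last first.
  by rewrite ltW// divr_gt0.
move=> h; apply: (le_trans (holder_local xy B_ge0 _)).
  by move=> c l l0 _; exact: oscB.
apply: (@le_trans _ _ (e / K * K)); last by rewrite divfK ?gt_eqF.
rewrite (_ : 2 * _ = `|x - y| `^ alpha * (2 * (C * B))); last first.
  by move: (_ `^ _) C => a C'; ring.
by apply: ler_pM; rewrite ?powR_ge0 ?(ltW h)// lerDl.
Unshelve. all: by end_near.
Qed.

(** Each [b] chooses the lower or the upper half in every coordinate, which indexes the $2^n$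
    halves. *)
Definition subcube_corner c l (b : {ffun 'I_n -> bool}) : 'rV[R]_n :=
  \row_i (c ord0 i + if b i then l / 2 else 0).

Lemma cube_halves c l : 0 < l ->
  cube c l `<=` \big[setU/set0]_(b : {ffun 'I_n -> bool})
    cube (subcube_corner c l b) (l / 2).
Proof.
move=> l0 x cx; rewrite -bigcup_seq.
exists [ffun i => c ord0 i + l / 2 <= x ord0 i]; first exact: mem_index_enum.
move=> i; rewrite mxE ffunE; have /andP[h1 h2] := cx i.
by case: (leP (c ord0 i + l / 2) (x ord0 i)) => h; apply/andP; split; lra.
Qed.

Let h x : \bar R := `|f x - g x|%:E.

Let measurable_h : measurable_fun setT (h : lebesgueType R n -> \bar R).
Proof.
have mg := continuous_measurable_rV campanato_continuous.
rewrite /h; apply/measurable_EFinP; apply: measurableT_comp.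
  exact: normr_measurable.
exact: (measurable_funB (proj1 lif) mg).
Qed.

(** In [1 + C], the 1 bounds the deviation of [f] from its average and [C] that of [g]. In the
    induction step the halves have total volume $l^n$, while $(l/2)^\alpha = r\, l^\alpha$ gives one
    more factor $r$. *)
Lemma integral_campanato c l k : 0 < l ->
  (\int[mu]_(x in cube c l) h x <=
   (l ^+ n * (l `^ alpha * ((1 + C) * B)) * r ^+ k)%:E)%E.
Proof.
elim: k c l => [c l l0|k IH c l l0].
  have lC : 0 <= C * (l `^ alpha * B).
    by apply: mulr_ge0 => //; exact: mulr_ge0 (powR_ge0 _ _) B_ge0.
  pose a := average f (cube c l).
  apply: (@le_trans _ _ (\int[mu]_(x in cube c l)
      (`|f x - a|%:E + cst (C * (l `^ alpha * B))%:E x))%E).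
    apply: ge0_le_integral.
    - exact: measurable_cube.
    - by move=> x _; rewrite lee_fin.
    - exact: measurable_funTS measurable_h.
    - apply: emeasurable_funD; first exact: (measurable_dist lif a).
      exact: measurable_cst.
    - move=> x cx; rewrite /h /= -EFinD lee_fin -(subrKA a).
      apply: (le_trans (ler_normD _ _)); rewrite lerD2l distrC.
      exact: gP.
  rewrite (ge0_integralD mu (measurable_cube c l) _
    (@measurable_dist _ _ _ lif a c l) _ (measurable_cst _)); last 2 first.
  - by move=> x _; rewrite lee_fin.
  - by move=> x _; rewrite lee_fin.
  rewrite integral_cst; last exact: measurable_cube.
  rewrite -(EFin_dev lif)// [X in (_ + _ * X)%E]lebesgue_cube ?(ltW l0)//.
  rewrite -EFinM -EFinD lee_fin.
  have := oscB c l0; rewrite osc_le// -/a => H.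
  apply: (le_trans (lerD H (lexx _))); rewrite le_eqVlt; apply/orP; left.
  by apply/eqP; rewrite expr0; move: (l `^ alpha) C => b C'; ring.
have l20 : 0 < l / 2 by rewrite divr_gt0.
apply: (le_trans (@ge0_integral_cover _ _ _ mu _
  (index_enum {ffun 'I_n -> bool}) _ _ _ _ _ measurable_h _ (cube_halves l0))).
- exact: measurable_cube.
- by move=> b; exact: measurable_cube.
- by move=> x; rewrite lee_fin.
apply: (le_trans (lee_sum _ (fun b _ => IH (subcube_corner c l b) _ l20))).
rewrite sumEFin lee_fin sumr_const card_ffun card_bool card_ord.
rewrite -[leLHS]mulr_natl natrX.
rewrite (_ : l ^+ n = 2 ^+ n * (l / 2) ^+ n); last first.
  by rewrite -exprMn mulrC divfK.
rewrite powRM ?(ltW l0)// exprS le_eqVlt; apply/orP; left; apply/eqP.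
by move: (2 ^+ n) ((l / 2) ^+ n) (l `^ alpha) (r) (_ ^+ k) C => *; ring.
Qed.

Lemma campanato_ae : f = g %[ae mu].
Proof.
have fgQ c l : 0 < l -> f = g %[ae mu in cube c l].
  move=> l0; have int0 : (\int[mu]_(x in cube c l) h x)%E = 0%E.
    have i0 : (0 <= \int[mu]_(x in cube c l) h x)%E.
      by apply: integral_ge0 => x _; rewrite lee_fin.
    have ik k := @integral_campanato c l k l0.
    have ifin : (\int[mu]_(x in cube c l) h x)%E \is a fin_num.
      by rewrite ge0_fin_numE//; apply: le_lt_trans (ik 0%N) _; rewrite ltry.
    apply/eqP; rewrite eq_le i0 andbT -(fineK ifin) lee_fin.
    apply: (@le_geometric _ r (half_powR_ge0 _) (half_powR_lt1 alpha_gt0) _ _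
      (l ^+ n * (l `^ alpha * ((1 + C) * B)))) => k.
    by rewrite add0r -lee_fin fineK.
  have /(ae_eq_integral_abs mu (measurable_cube c l)) : 
      (\int[mu]_(x in cube c l) `|h x|)%E = 0%E.
    by rewrite -[RHS]int0; apply: eq_integral => x _; rewrite gee0_abs ?lee_fin.
  move=> /(_ (measurable_funTS measurable_h)).
  apply: (@filterS _ _ (ae_filter_ringOfSetsType mu)) => x /= hx /hx [] /eqP.
  by rewrite normr_eq0 subr_eq0 => /eqP.
(* The cubes with corner $(-k, \dots, -k)$ and edge $2k + 1$ exhaust the space; the added 1 keeps
   the edge positive at $k = 0$. *)
have := @ae_foralln _ _ _ mu _
  (fun k => fgQ (- const_mx k%:R) _ (ltr0Sn R (k + k))).
apply: (@filterS _ _ (ae_filter_ringOfSetsType mu)) => x /= fx _.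
apply: (fx (Num.bound `|x|)) => i; rewrite !mxE.
have : `|x ord0 i| <= (Num.bound `|x|)%:R.
  apply: (le_trans (coord_le_norm x i)); apply: ltW.
  by have := archi_boundP (normr_ge0 x).
rewrite ler_norml -natr1 natrD => /andP[? ?].
by apply/andP; split; lra.
Qed.

End holder.

(** For eventually nonnegative extended reals, a one-sided bound is enough and also yields
    finiteness. Large inequalities are the form in which bounds on suprema are available. *)
Lemma cvge0_le (R : realType) (T : Type) (F : set_system T) (FF : Filter F)
    (u : T -> \bar R) : (\forall a \near F, (0 <= u a)%E) ->
  u a @[a --> F] --> 0%E <->
  forall e, 0 < e -> \forall a \near F, (u a <= e%:E)%E.
Proof.
move=> u0; split.
  move=> /fine_cvgP[ufin /cvgr0Pnorm_le ule] e e0.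
  near=> a; have afin : u a \is a fin_num by near: a.
  rewrite -(fineK afin) lee_fin; apply: (le_trans (ler_norm _)).
  by near: a; exact: ule.
move=> ue; apply/fine_cvgP; split.
  near=> a; rewrite ge0_fin_numE; last by near: a.
  by apply: (@le_lt_trans _ _ 1%:E); [near: a; exact: ue|rewrite ltry].
apply/cvgr0Pnorm_le => e e0; near=> a.
have a0 : (0 <= u a)%E by near: a.
have ae : (u a <= e%:E)%E by near: a; exact: ue.
rewrite /= ger0_norm ?fine_ge0// -lee_fin fineK// ge0_fin_numE//.
by apply: le_lt_trans ae _; rewrite ltry.
Unshelve. all: by end_near.
Qed.

(** * Bounds on the suprema, elementary geometry of cubes, and the representative *)

Section suprema.
Variables (R : realType) (n : nat) (alpha : R).
Implicit Types (f g : 'rV[R]_n -> R) (c x y z : 'rV[R]_n) (l E : R).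

Lemma sup_osc_le f (P : set R) E : (sup_osc alpha f P <= E%:E)%E <->
  forall c l, P l -> 0 < l -> (osc alpha f (cube c l) <= E%:E)%E.
Proof.
split=> [h c l Pl l0|h].
  apply: le_trans h; apply: ereal_sup_ubound.
  by exists (cube c l) => //; exists l => //; split=> //; exists c.
by apply: ge_ereal_sup => _ [_ [l Pl [l0 [c ->]]] <-]; exact: h.
Qed.

(** The edge [l] shows that the family of cubes is not empty; an empty supremum would be
    $-\infty$. *)
Lemma sup_osc_ge0 f (P : set R) l : (0 < n)%N -> locally_integrable_rV f ->
  P l -> 0 < l -> (0 <= sup_osc alpha f P)%E.
Proof.
move=> n0 lif Pl l0; apply: (le_trans (osc_ge0 alpha n0 lif 0 l0)).
apply: ereal_sup_ubound.
by exists (cube 0 l) => //; exists l => //; split=> //; exists 0.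
Qed.

Lemma sup_holder_le g D E : (forall p, D p -> 0 < enorm (p.1 - p.2)) ->
  (sup_holder alpha g D <= E%:E)%E <->
  forall x y, D (x, y) -> `|g x - g y| <= E * enorm (x - y) `^ alpha.
Proof.
move=> D0; split=> [h x y Dxy|h].
  rewrite -ler_pdivrMr ?powR_gt0 ?(D0 _ Dxy)// -lee_fin.
  by apply: le_trans h; apply: ereal_sup_ubound; exists (x, y).
apply: ge_ereal_sup => _ [[x y] Dxy <-] /=; rewrite lee_fin.
by rewrite ler_pdivrMr ?powR_gt0 ?(D0 _ Dxy)//; exact: h.
Qed.

Lemma sup_holder_ge0 g D p : D p -> (0 <= sup_holder alpha g D)%E.
Proof.
move=> Dp; apply: le_trans (ereal_sup_ubound _); last first.
  by exists p; first exact: Dp.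
by rewrite lee_fin divr_ge0 ?powR_ge0.
Qed.

Lemma enorm_gt0 x y : x != y -> 0 < enorm (x - y).
Proof. by move=> /norm_subr_gt0 /lt_le_trans; apply; exact: norm_le_enorm. Qed.

Lemma translate_cube c l z : translate (cube c l) z = cube (c + z) l.
Proof.
apply/seteqP; split => [_ [x cx <-] i|x cx].
  by have /andP[? ?] := cx i; rewrite !mxE; apply/andP; split; lra.
exists (x - z); last by rewrite subrK.
by move=> i; have := cx i; rewrite !mxE => /andP[? ?]; apply/andP; split; lra.
Qed.

Lemma cube_corner c l : 0 <= l -> cube c l c.
Proof. by move=> l0 i; rewrite lexx lerDl. Qed.

Lemma cube_vertex c l : 0 <= l -> cube c l (c + const_mx l).
Proof. by move=> l0 i; rewrite !mxE lexx lerDl l0. Qed.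

Lemma subset_cube_edge c l c' l' : (0 < n)%N -> 0 <= l' ->
  cube c' l' `<=` cube c l -> l' <= l.
Proof.
move=> n0 l0 cc; have /andP[h1 _] := cc _ (cube_corner _ l0) (Ordinal n0).
have := cc _ (cube_vertex _ l0) (Ordinal n0).
by rewrite !mxE => /andP[_ h2]; lra.
Qed.

Lemma cube_dist_le c l x y :
  0 <= l -> cube c l x -> cube c l y -> `|x - y| <= l.
Proof.
move=> l0 cx cy; have [->|xy] := eqVneq x y; first by rewrite subrr normr0.
have [[a i] /= ->] : exists i : 'I_1 * 'I_n, `|x - y| = `|(x - y) i.1 i.2|.
  by apply: mx_norm_neq0; move: xy; rewrite -subr_eq0 -normr_eq0.
rewrite (ord1 a) !mxE ler_norml; have /andP[? ?] := cx i.
by have /andP[? ?] := cy i; apply/andP; split; lra.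
Qed.

Lemma cube_norm_le c l x : (0 < n)%N -> cube c l x -> `|x - c| <= l.
Proof.
move=> n0 cx; have l0 : 0 <= l by have /andP[? ?] := cx (Ordinal n0); lra.
by apply: cube_dist_le cx (cube_corner _ l0).
Qed.

Lemma cube_enorm_powR c l x : (0 < n)%N -> 0 < alpha -> cube c l x ->
  enorm (x - c) `^ alpha <= l `^ alpha * n%:R `^ alpha.
Proof.
move=> n0 a0 cx; have xl := cube_norm_le n0 cx.
have l0 : 0 <= l := le_trans (normr_ge0 _) xl.
rewrite -powRM//; apply: ge0_ler_powR; rewrite ?nnegrE ?(ltW a0) ?enorm_ge0//.
  by rewrite mulr_ge0.
by apply: (le_trans (enorm_le_norm _ n0)); rewrite mulrC ler_wpM2r.
Qed.

Lemma norm_powR_le x : 0 < alpha -> `|x| `^ alpha <= enorm x `^ alpha.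
Proof.
move=> a0; apply: ge0_ler_powR; rewrite ?nnegrE ?(ltW a0) ?enorm_ge0//.
exact: norm_le_enorm.
Qed.

(** The average is replaced by the value of [g] at the corner, at the cost of the factor 2. *)
Lemma osc_corner f g c l E : (0 < n)%N -> 0 < alpha ->
  locally_integrable_rV f -> f = g %[ae @lebesgue_rV R n] -> 0 < l ->
  (forall x, cube c l x -> `|g x - g c| <= l `^ alpha * E) ->
  (osc alpha f (cube c l) <= (2 * E)%:E)%E.
Proof.
move=> n0 a0 lif fg l0 gE; rewrite osc_le//.
apply: (le_trans (dev_average lif _ (g c) l0)).
have := dev_ae_le lif l0 fg gE; set a := dev _ _ _.
rewrite -(ler_pM2l (ltr0Sn R 1)) => h; apply: (le_trans h).
rewrite le_eqVlt; apply/orP; left; apply/eqP.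
by move: (l `^ alpha) (l ^+ n) => b b'; ring.
Qed.

Lemma osc_corner_holder f g c l E : (0 < n)%N -> 0 < alpha -> 0 <= E ->
  locally_integrable_rV f -> f = g %[ae @lebesgue_rV R n] -> 0 < l ->
  (forall x, cube c l x -> x != c ->
    `|g x - g c| <= E * enorm (x - c) `^ alpha) ->
  (osc alpha f (cube c l) <= (2 * (n%:R `^ alpha * E))%:E)%E.
Proof.
move=> n0 a0 E0 lif fg l0 gE; apply: (osc_corner n0 a0 lif fg l0) => x cx.
have [->|xc] := eqVneq x c.
  by rewrite subrr normr0 !mulr_ge0 ?powR_ge0.
apply: (le_trans (gE x cx xc)); rewrite mulrC mulrA ler_wpM2r//.
exact: cube_enorm_powR.
Qed.

Lemma BMO_representative f : (0 < n)%N -> 0 < alpha -> BMO alpha f ->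
  exists B g, [/\ 0 <= B,
    (forall x c l, 0 < l -> cube c l x ->
      `|g x - average f (cube c l)| <=
        campanato_const n alpha * (l `^ alpha * B)) &
    continuous_representative f g].
Proof.
move=> n0 a0 [lif fB]; have s0 := @sup_osc_ge0 f setT 1 n0 lif I ltr01.
have sfin : sup_osc alpha f setT \is a fin_num by rewrite ge0_fin_numE.
have B0 : 0 <= fine (sup_osc alpha f setT) by exact: fine_ge0.
have oB c l : 0 < l ->
    (osc alpha f (cube c l) <= (fine (sup_osc alpha f setT))%:E)%E.
  by move=> l0; apply: (sup_osc_le f setT _).1 => //; rewrite fineK.
have [g gP] := campanato_pointwise n0 a0 lif B0 oB.
exists (fine (sup_osc alpha f setT)), g; split=> //; split.
  exact: (campanato_continuous n0 a0 lif B0 oB gP).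
exact: (campanato_ae n0 a0 lif B0 oB gP).
Qed.

End suprema.

(** * The vanishing conditions in epsilon form *)

Section vanishing.
Variables (R : realType) (n : nat) (alpha : R) (f : 'rV[R]_n -> R).
Hypotheses (n_gt0 : (0 < n)%N) (alpha_gt0 : 0 < alpha).
Hypothesis lif : locally_integrable_rV f.
Implicit Types (g : 'rV[R]_n -> R) (c x y z : 'rV[R]_n) (l e : R).

(** The families increase with [a], so a bound at one positive [a] persists for all smaller ones. *)
Lemma cvg0_sup_oscP :
  sup_osc alpha f [set l | l <= a] @[a --> 0^'+] --> 0%E <->
  forall e, 0 < e -> exists2 a, 0 < a &
    forall c l, 0 < l <= a -> (osc alpha f (cube c l) <= e%:E)%E.
Proof.
rewrite cvge0_le; last first.
  near=> a; apply: (@sup_osc_ge0 _ _ _ _ _ a) => //=.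
split=> H e /H.
  move=> He; have [a [a0 /sup_osc_le aE]] :=
    filter_ex (filterI (nbhs_right_gt (0 : R)) He).
  by exists a => // c l /andP[l0 la]; exact: aE.
move=> [a a0 aE]; near=> b; apply/sup_osc_le => c l /= lb l0.
apply: aE; rewrite l0/=; apply: (le_trans lb).
by near: b; exact: nbhs_right_le.
Unshelve. all: by end_near.
Qed.

Lemma cvgy_sup_oscP :
  sup_osc alpha f [set l | a <= l] @[a --> +oo] --> 0%E <->
  forall e, 0 < e -> exists2 a, 0 < a &
    forall c l, a <= l -> (osc alpha f (cube c l) <= e%:E)%E.
Proof.
rewrite cvge0_le; last first.
  near=> a; apply: (@sup_osc_ge0 _ _ _ _ _ a) => //=.
split=> H e /H.
  move=> He; have [a [a0 /sup_osc_le aE]] :=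
    filter_ex (filterI (nbhs_pinfty_gt (num_real (0 : R))) He).
  by exists a => // c l la; apply: aE => //; exact: lt_le_trans la.
move=> [a a0 aE]; near=> b; apply/sup_osc_le => c l /= bl l0.
apply: aE; apply: le_trans bl.
by near: b; apply: nbhs_pinfty_ge; exact: num_real.
Unshelve. all: by end_near.
Qed.

Lemma cvg_osc_translateP c l : 0 < l ->
  osc alpha f (translate (cube c l) z) @[z --> einfty] --> 0%E <->
  forall e, 0 < e -> \forall z \near einfty,
    (osc alpha f (cube (c + z) l) <= e%:E)%E.
Proof.
move=> l0; under eq_fun do rewrite translate_cube.
by rewrite cvge0_le//; near=> z; exact: osc_ge0.
Unshelve. all: by end_near.
Qed.

Variable g : 'rV[R]_n -> R.

Lemma norm_const_mx (a : R) : 0 <= a -> `|const_mx a : 'rV[R]_n| = a.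
Proof.
move=> a0; apply/eqP; rewrite eq_le; apply/andP; split.
  by have := cube_norm_le n_gt0 (cube_vertex 0 a0); rewrite subr0 add0r.
have := coord_le_norm (const_mx a) (Ordinal n_gt0).
by rewrite mxE ger0_norm.
Qed.

Lemma cvg0_sup_holderP :
  sup_holder alpha g [set p | 0 < enorm (p.1 - p.2) <= a]
    @[a --> 0^'+] --> 0%E <->
  forall e, 0 < e -> exists2 a, 0 < a &
    forall x y, 0 < enorm (x - y) <= a ->
      `|g x - g y| <= e * enorm (x - y) `^ alpha.
Proof.
have D0 (a : R) (p : 'rV[R]_n * 'rV[R]_n) :
  [set p | 0 < enorm (p.1 - p.2) <= a] p -> 0 < enorm (p.1 - p.2) by case/andP.
rewrite cvge0_le; last first.
  near=> a; have a0 : 0 < a by [].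
  have an : 0 < a / n%:R by rewrite divr_gt0// ltr0n.
  (* A pair at max distance [a / n], hence at Euclidean distance at most [a]: the supremum is over a
     nonempty set. *)
  apply: (@sup_holder_ge0 _ _ _ _ _ (const_mx (a / n%:R), 0)) => /=.
  rewrite subr0; apply/andP; split.
    by apply: lt_le_trans (norm_le_enorm _); rewrite norm_const_mx// ltW.
  apply: (le_trans (enorm_le_norm _ n_gt0)); rewrite norm_const_mx ?(ltW an)//.
  by rewrite mulrC divfK// pnatr_eq0 -lt0n.
split=> H e /H.
  move=> He; have [a [a0 /(sup_holder_le _ _ _ (@D0 a)) aE]] :=
    filter_ex (filterI (nbhs_right_gt (0 : R)) He).
  by exists a => // x y xya; exact: aE.
move=> [a a0 aE]; near=> b.
apply/(sup_holder_le _ _ _ (@D0 b)) => x y /= /andP[xy xyb].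
apply: aE; rewrite xy/=; apply: (le_trans xyb).
by near: b; exact: nbhs_right_le.
Unshelve. all: by end_near.
Qed.

Lemma cvgy_sup_holderP :
  sup_holder alpha g [set p | a <= enorm (p.1 - p.2)]
    @[a --> +oo] --> 0%E <->
  forall e, 0 < e -> exists2 a, 0 < a &
    forall x y, a <= enorm (x - y) ->
      `|g x - g y| <= e * enorm (x - y) `^ alpha.
Proof.
have D0 (a : R) (a0 : 0 < a) (p : 'rV[R]_n * 'rV[R]_n) :
  [set p | a <= enorm (p.1 - p.2)] p -> 0 < enorm (p.1 - p.2).
  by move=> /=; exact: lt_le_trans.
rewrite cvge0_le; last first.
  near=> a; have a0 : 0 < a by [].
  apply: (@sup_holder_ge0 _ _ _ _ _ (const_mx a, 0)) => /=.
  rewrite subr0; apply: le_trans (norm_le_enorm _).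
  by rewrite norm_const_mx// ltW.
split=> H e /H.
  move=> He; have [a [a0 aE]] :=
    filter_ex (filterI (nbhs_pinfty_gt (num_real (0 : R))) He).
  exists a => // x y xya; exact: (sup_holder_le _ _ _ (D0 a a0)).1 aE x y xya.
move=> [a a0 aE]; near=> b.
have b0 : 0 < b by [].
apply/(sup_holder_le _ _ _ (D0 b b0)) => x y /= xyb.
apply: aE; apply: le_trans xyb.
by near: b; apply: nbhs_pinfty_ge; exact: num_real.
Unshelve. all: by end_near.
Qed.

Lemma cvg_sup_holder_translateP c l : 0 < l ->
  sup_holder alpha g
    [set p | [/\ translate (cube c l) z p.1, translate (cube c l) z p.2 &
                p.1 != p.2]] @[z --> einfty] --> 0%E <->
  forall e, 0 < e -> \forall z \near einfty, forall x y,
    cube (c + z) l x -> cube (c + z) l y -> x != y ->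
    `|g x - g y| <= e * enorm (x - y) `^ alpha.
Proof.
move=> l0; under eq_fun do rewrite translate_cube.
have D0 z (p : 'rV[R]_n * 'rV[R]_n) :
  [set p | [/\ cube (c + z) l p.1, cube (c + z) l p.2 & p.1 != p.2]] p ->
  0 < enorm (p.1 - p.2) by case=> _ _; exact: enorm_gt0.
rewrite cvge0_le; last first.
  near=> z; apply: (@sup_holder_ge0 _ _ _ _ _ (c + z + const_mx l, c + z)).
  split=> /=; [exact: cube_vertex (ltW l0)|exact: cube_corner (ltW l0)|].
  rewrite -subr_eq0 addrC addKr -normr_eq0 norm_const_mx ?(ltW l0)//.
  by rewrite gt_eqF.
split=> H e /H; apply: filterS => z.
  by move=> /(sup_holder_le _ _ _ (@D0 z)) h x y cx cy xy; exact: h.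
by move=> h; apply/(sup_holder_le _ _ _ (@D0 z)) => x y [/= cx cy xy]; exact: h.
Unshelve. all: by end_near.
Qed.

End vanishing.

(** * From the pointwise conditions to the oscillations *)

Section from_holder.
Variables (R : realType) (n : nat) (alpha : R) (f g : 'rV[R]_n -> R).
Hypotheses (n_gt0 : (0 < n)%N) (alpha_gt0 : 0 < alpha).
Hypothesis lif : locally_integrable_rV f.
Hypothesis fg : f = g %[ae @lebesgue_rV R n].
Implicit Types (c x y z : 'rV[R]_n) (l e : R).

Local Notation N := (n%:R `^ alpha : R).

Let N_gt0 : 0 < N. Proof. by rewrite powR_gt0// ltr0n. Qed.

Lemma osc_small_of_holder :
  sup_holder alpha g [set p | 0 < enorm (p.1 - p.2) <= a]
    @[a --> 0^'+] --> 0%E ->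
  sup_osc alpha f [set l | l <= a] @[a --> 0^'+] --> 0%E.
Proof.
move=> /(cvg0_sup_holderP _ n_gt0) H; apply/cvg0_sup_oscP => // e e0.
have E0 : 0 < e / (2 * N) by rewrite divr_gt0// mulr_gt0.
(* Within a cube of edge at most [a / n], the Euclidean distance to the corner is at most [a]. *)
have [a a0 aE] := H _ E0; exists (a / n%:R) => [|c l /andP[l0 la]].
  by rewrite divr_gt0// ltr0n.
rewrite (_ : e = 2 * (N * (e / (2 * N)))); last by field; rewrite gt_eqF.
apply: (osc_corner_holder n_gt0 alpha_gt0 (ltW E0) lif fg l0) => x cx xc.
apply: aE; rewrite enorm_gt0//=; apply: (le_trans (enorm_le_norm _ n_gt0)).
rewrite -ler_pdivlMl ?ltr0n// mulrC; apply: le_trans la.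
exact: cube_norm_le cx.
Qed.

Lemma osc_translate_of_holder c l : 0 < l ->
  sup_holder alpha g
    [set p | [/\ translate (cube c l) z p.1, translate (cube c l) z p.2 &
                p.1 != p.2]] @[z --> einfty] --> 0%E ->
  osc alpha f (translate (cube c l) z) @[z --> einfty] --> 0%E.
Proof.
move=> l0 /(cvg_sup_holder_translateP _ n_gt0 _ _ l0) H.
apply/cvg_osc_translateP => // e e0.
have E0 : 0 < e / (2 * N) by rewrite divr_gt0// mulr_gt0.
apply: filterS (H _ E0) => z zE.
rewrite (_ : e = 2 * (N * (e / (2 * N)))); last by field; rewrite gt_eqF.
apply: (osc_corner_holder n_gt0 alpha_gt0 (ltW E0) lif fg l0) => x cx xc.
by apply: zE => //; exact: cube_corner (ltW l0).
Qed.

(* Points of a large cube close to its lower corner are compared with the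
   corner through the opposite vertex, which is far from both. *)
Lemma osc_large_of_holder :
  sup_holder alpha g [set p | a <= enorm (p.1 - p.2)]
    @[a --> +oo] --> 0%E ->
  sup_osc alpha f [set l | a <= l] @[a --> +oo] --> 0%E.
Proof.
move=> /(cvgy_sup_holderP _ n_gt0) H; apply/cvgy_sup_oscP => // e e0.
(* In [4 * N], one factor 2 is lost in [osc_corner], the other in the detour through the opposite
   vertex, and [N] in the change of norm. *)
have E0 : 0 < e / (4 * N) by rewrite divr_gt0// mulr_gt0.
have [a a0 aE] := H _ E0.
(* The opposite vertex is at max distance [l] from the corner; with [l] at least [2 * a], it is at
   distance at least [a] from every point closer than [a] to the corner. *)
exists (2 * a) => [|c l la]; first by rewrite mulr_gt0.
have l0 : 0 < l by apply: lt_le_trans la; rewrite mulr_gt0.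
rewrite (_ : e = 2 * (2 * (N * (e / (4 * N))))); last by field; rewrite gt_eqF.
have far x y w : `|x - w| <= l -> a <= enorm (x - w) ->
    `|g x - g w| <= l `^ alpha * (N * (e / (4 * N))).
  move=> xl ax; apply: (le_trans (aE _ _ ax)); rewrite mulrC mulrA.
  apply: ler_wpM2r; first exact: ltW.
  rewrite -powRM ?(ltW l0)//; apply: ge0_ler_powR.
  - exact: ltW.
  - by rewrite nnegrE enorm_ge0.
  - by rewrite nnegrE mulr_ge0// ltW.
  - by apply: (le_trans (enorm_le_norm _ n_gt0)); rewrite mulrC ler_wpM2r.
apply: (osc_corner n_gt0 alpha_gt0 lif fg l0) => x cx.
have K0 : 0 <= l `^ alpha * (N * (e / (4 * N))).
  by rewrite mulr_ge0 ?powR_ge0// mulr_ge0 ?powR_ge0// ltW.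
have [ax|xa] := leP a (enorm (x - c)).
  apply: (le_trans (far x c c (cube_norm_le n_gt0 cx) ax)).
  by rewrite [leRHS]mulrCA [leRHS]mulr_natl mulr2n lerDl.
pose w := c + const_mx l.
have wc : `|w - c| = l by rewrite addrC addKr norm_const_mx// ltW.
have xw : `|w - x| <= l.
  exact: cube_dist_le (ltW l0) (cube_vertex _ (ltW l0)) cx.
rewrite -(subrKA (g w)) [X in _ * X]mulr_natl mulr2n.
rewrite mulrDr; apply: (le_trans (ler_normD _ _)); apply: lerD.
  rewrite distrC; apply: far => //.
  apply: le_trans (norm_le_enorm _).
  have := ler_normD (w - x) (x - c); rewrite addrA subrK wc.
  have := norm_le_enorm (x - c); lra.
apply: far => //; first by rewrite wc.
by apply: le_trans (norm_le_enorm _); rewrite wc; lra.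
Qed.

End from_holder.

(** * From the oscillations to the pointwise conditions *)

Section to_holder.
Variables (R : realType) (n : nat) (alpha : R) (f g : 'rV[R]_n -> R).
Hypotheses (n_gt0 : (0 < n)%N) (alpha_gt0 : 0 < alpha).
Hypothesis lif : locally_integrable_rV f.
Variable B : R.
Hypothesis B_ge0 : 0 <= B.
Implicit Types (c x y z : 'rV[R]_n) (l e : R).

Local Notation C := (campanato_const n alpha).
Local Notation r := (2^-1 `^ alpha).

Hypothesis gP : forall x c l,
  0 < l -> cube c l x -> `|g x - average f (cube c l)| <= C * (l `^ alpha * B).

Let C_gt0 : 0 < C.
Proof. by rewrite divr_gt0 ?exprn_gt0// subr_gt0 half_powR_lt1. Qed.

Lemma holder_enorm x y e : x != y -> 0 < e ->
  (forall c l, 0 < l -> cube c l `<=` cube (min_corner x y) `|x - y| ->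
    (osc alpha f (cube c l) <= (e / (2 * C))%:E)%E) ->
  `|g x - g y| <= e * enorm (x - y) `^ alpha.
Proof.
move=> xy e0 oE; have E0 : 0 < e / (2 * C).
  by apply: divr_gt0 => //; exact: mulr_gt0.
apply: (le_trans (holder_local n_gt0 alpha_gt0 lif gP xy (ltW E0) oE)).
rewrite (_ : 2 * _ = e * `|x - y| `^ alpha).
  by rewrite ler_pM2l//; exact: norm_powR_le.
by move: C C_gt0 (_ `^ _) => C' C'0 a; field; rewrite gt_eqF.
Qed.

Lemma holder_small_of_osc :
  sup_osc alpha f [set l | l <= a] @[a --> 0^'+] --> 0%E ->
  sup_holder alpha g [set p | 0 < enorm (p.1 - p.2) <= a]
    @[a --> 0^'+] --> 0%E.
Proof.
move=> /(cvg0_sup_oscP _ n_gt0 lif) H; apply/cvg0_sup_holderP => // e e0.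
have E0 : 0 < e / (2 * C).
  by apply: divr_gt0 => //; exact: mulr_gt0.
have [a a0 aE] := H _ E0; exists a => // x y /andP[xy0 xya].
have xy : x != y.
  apply: contraTneq xy0 => ->; rewrite subrr -leNgt.
  by rewrite (le_trans (enorm_le_norm _ n_gt0))// normr0 mulr0.
apply: holder_enorm => // c l l0 cl; apply: aE; rewrite l0/=.
apply: le_trans xya; apply: le_trans (norm_le_enorm _).
exact: subset_cube_edge n_gt0 (ltW l0) cl.
Qed.

(** Subcubes of small edge are controlled uniformly by the VMO condition. The others have edges
    comparable to [l] and inherit, by [osc_subset], the decay of the oscillation over one translated
    cube. *)
Lemma holder_translate_of_osc c l : 0 < l ->
  sup_osc alpha f [set l | l <= a] @[a --> 0^'+] --> 0%E ->
  osc alpha f (translate (cube c (2 * l)) z) @[z --> einfty] --> 0%E ->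
  sup_holder alpha g
    [set p | [/\ translate (cube c l) z p.1, translate (cube c l) z p.2 &
                p.1 != p.2]] @[z --> einfty] --> 0%E.
Proof.
move=> l0 /(cvg0_sup_oscP _ n_gt0 lif) H.
have l20 : 0 < 2 * l by rewrite mulr_gt0.
move=> /(cvg_osc_translateP _ n_gt0 lif _ l20) HX.
apply/cvg_sup_holder_translateP => // e e0.
have E0 : 0 < e / (2 * C).
  by apply: divr_gt0 => //; exact: mulr_gt0.
(* [q] bounds the ratio of the edges of the doubled cube and of any subcube of edge larger than
   [a]. *)
have [a a0 aE] := H _ E0; pose q := 2 * l / a.
have q0 : 0 < q by rewrite divr_gt0.
have D0 : 0 < 2 * q ^+ n * q `^ alpha.
  by rewrite mulr_gt0 ?powR_gt0// mulr_gt0// exprn_gt0.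
have d0 : 0 < e / (2 * C) / (2 * q ^+ n * q `^ alpha) by apply: divr_gt0.
apply: filterS (HX _ d0) => z zE x y cx cy xy.
apply: holder_enorm => // c' l' l'0 cl'.
have [l'a|al'] := leP l' a; first by apply: aE; rewrite l'0.
(* The spanned cube may leave the translated cube, but its corner lies there and its edge is at most
   [l]: doubling the edge suffices. *)
have sub : cube c' l' `<=` cube (c + z) (2 * l).
  apply: (subset_trans cl'); apply: subset_cube => i.
  have := cx i; have := cy i; have := min_corner_cube x y i.
  have xyl := cube_dist_le (ltW l0) cx cy.
  rewrite !mxE => /andP[? ?] /andP[? ?] /andP[? ?].
  by split; [rewrite le_min; apply/andP; split; lra|lra].
apply: (le_trans (osc_subset n_gt0 lif l20 l'0 sub zE)).
rewrite lee_fin -[leRHS](mulfVK (lt0r_neq0 D0)) mulrC.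
apply: ler_wpM2l; first exact: ltW.
have ql : 2 * l / l' <= q by rewrite ler_pM2l// lef_pV2// ltW.
have ql0 : 0 <= 2 * l / l' by rewrite divr_ge0// ltW.
apply: ler_pM.
- by rewrite mulr_ge0// exprn_ge0.
- exact: powR_ge0.
- by rewrite ler_pM2l// ler_pXn2r// nnegrE// ltW.
- by apply: ge0_ler_powR => //; rewrite ?nnegrE ?(ltW q0) ?(ltW alpha_gt0).
Qed.

(* The chain of subcubes of a large cube is cut as soon as the edge falls below
   the threshold beyond which oscillations are small; the remaining part only
   contributes a bounded quantity, negligible next to [|x - y|^alpha]. *)
Lemma holder_large_of_osc :
  sup_osc alpha f [set l | a <= l] @[a --> +oo] --> 0%E ->
  sup_holder alpha g [set p | a <= enorm (p.1 - p.2)]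
    @[a --> +oo] --> 0%E.
Proof.
move=> /(cvgy_sup_oscP _ n_gt0 lif) H; apply/cvgy_sup_holderP => // e e0.
(* The 4 counts two endpoints, each with a chain part and a remainder. *)
have E0 : 0 < e / (4 * C) by apply: divr_gt0 => //; exact: mulr_gt0.
pose E := e / (4 * C).
(* Solves $b^\alpha E = a^\alpha B$, so that beyond max distance [b] the remainder $C a^\alpha B$ is
   absorbed. *)
have [a a0 aE] := H _ E0; pose b := (a `^ alpha * B / E) `^ alpha^-1.
have b0 : 0 <= b by exact: powR_ge0.
(* The factor $n$ passes from the Euclidean to the max norm; the 1 keeps the threshold positive when
   [b] is 0. *)
exists (n%:R * b + 1) => [|x y xyb]; first by rewrite ltr_wpDl// mulr_ge0.
have xy : x != y.
  apply: contraTneq xyb => ->; rewrite -ltNge.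
  apply: (le_lt_trans (enorm_le_norm _ n_gt0)).
  by rewrite subrr normr0 mulr0 ltr_wpDl// mulr_ge0.
have s0 := norm_subr_gt0 xy; set s := `|x - y| in s0 *.
have bs : b <= s.
  have n0R : 0 < n%:R :> R by rewrite ltr0n.
  rewrite -(ler_pM2l n0R); apply: le_trans (enorm_le_norm _ n_gt0).
  by apply: le_trans xyb; rewrite lerDl.
have aBs : a `^ alpha * B <= s `^ alpha * E.
  rewrite -ler_pdivrMr//.
  have aBE : 0 <= a `^ alpha * B / E.
    by rewrite divr_ge0 ?(ltW E0)// mulr_ge0 ?powR_ge0.
  rewrite -[leLHS]powRr1// -(mulVf (lt0r_neq0 alpha_gt0)) powRrM.
  by apply: ge0_ler_powR; rewrite ?nnegrE ?(ltW alpha_gt0)// ltW.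
have cx := min_corner_cube x y.
have cy : cube (min_corner x y) `|x - y| y.
  by rewrite min_cornerC distrC; exact: min_corner_cube.
have exk : exists k, 2^-1 ^+ k * s <= a.
  have h0 : 0 <= 2^-1 :> R by rewrite invr_ge0.
  have h1 : 2^-1 < 1 :> R by rewrite invf_lt1// ltr1n.
  have [k ks] := geometric_lt h0 h1 s a0.
  by exists k; rewrite mulrC ltW.
(* By minimality, every cube before the [k]-th has edge at least [a], hence small oscillation. *)
pose k := ex_minn exk.
have ka : 2^-1 ^+ k * s <= a by rewrite /k; case: ex_minnP.
have jk j : (j < k)%N -> a <= 2^-1 ^+ j * s.
  rewrite /k; case: ex_minnP => m _ mmin jm; rewrite leNgt; apply/negP => /ltW.
  by move=> /mmin; rewrite leqNgt jm.
have key z : cube (min_corner x y) s z ->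
    `|g z - average f (cube (min_corner x y) s)| <= 2 * (C * (s `^ alpha * E)).
  move=> cz.
  apply: (le_trans (campanato_truncated n_gt0 alpha_gt0 lif gP s0 cz (ltW E0)
    (k := k) _)).
    by move=> j /jk aj; apply: aE.
  rewrite [leRHS]mulr_natl mulr2n lerD2l ler_pM2l//; apply: le_trans aBs.
  apply: ler_wpM2r => //.
  apply: ge0_ler_powR; rewrite ?nnegrE ?(ltW alpha_gt0)//.
    by rewrite mulr_ge0 ?(ltW s0)// exprn_ge0.
  exact: ltW.
rewrite -(subrKA (average f (cube (min_corner x y) s))).
apply: (le_trans (ler_normD _ _)); rewrite [X in _ + X <= _]distrC.
apply: (le_trans (lerD (key _ cx) (key _ cy))).
rewrite (_ : _ + _ = e * s `^ alpha).
  by rewrite ler_pM2l//; exact: norm_powR_le.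
rewrite /E; move: C C_gt0 (_ `^ _) => C' C'0 d; field; by rewrite gt_eqF.
Qed.

End to_holder.

Theorem proposition3p4 (R : realType) (n : nat) (n_gt0 : (0 < n)%N)
    (alpha : R) (alpha_gt0 : 0 < alpha) (alpha_lt1 : alpha < 1)
    (f : 'rV[R]_n -> R) :
  [/\ VMO alpha f <->
      BMO alpha f /\
      exists2 g, continuous_representative f g &
        sup_holder alpha g [set p | 0 < enorm (p.1 - p.2) <= a]
          @[a --> 0^'+] --> 0%E,
      XMO alpha f <->
      VMO alpha f /\
      exists2 g, continuous_representative f g &
        forall (l : R) (Q : set 'rV[R]_n), is_cube l Q ->
          sup_holder alpha g
            [set p | [/\ translate Q z p.1, translate Q z p.2 & p.1 != p.2]]
            @[z --> einfty] --> 0%E &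
      CMO alpha f <->
      XMO alpha f /\
      exists2 g, continuous_representative f g &
        sup_holder alpha g [set p | a <= enorm (p.1 - p.2)]
          @[a --> +oo] --> 0%E].
Proof.
(* The forward implications exhibit the function built from limits of averages; the converses start
   from any given continuous representative. *)
have rep : BMO alpha f -> exists B g, [/\ 0 <= B,
    (forall x c l, 0 < l -> cube c l x -> `|g x - average f (cube c l)| <=
      campanato_const n alpha * (l `^ alpha * B)) &
    continuous_representative f g] by exact: BMO_representative.
split; split.
- move=> [fB fV]; split=> //; have [B [g [_ gP grep]]] := rep fB.
  exists g => //.
  exact: (holder_small_of_osc n_gt0 alpha_gt0 fB.1 gP fV).
- move=> [fB [g grep gH]]; split=> //.
  exact: (osc_small_of_holder n_gt0 alpha_gt0 fB.1 grep.2 gH).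
- move=> [fV fX]; split=> //; have [B [g [_ gP grep]]] := rep fV.1.
  exists g => // l _ [l0 [c ->]].
  apply: (holder_translate_of_osc n_gt0 alpha_gt0 fV.1.1 gP l0 fV.2).
  by apply: (fX (2 * l)); split; [rewrite mulr_gt0|exists c].
- move=> [fV [g grep gH]]; split=> // l _ [l0 [c ->]].
  apply: (osc_translate_of_holder n_gt0 alpha_gt0 fV.1.1 grep.2 l0).
  by apply: (gH l); split=> //; exists c.
- move=> [fX fC]; split=> //; have [B [g [B0 gP grep]]] := rep fX.1.1.
  exists g => //.
  exact: (holder_large_of_osc n_gt0 alpha_gt0 fX.1.1.1 B0 gP fC).
- move=> [fX [g grep gH]]; split=> //.
  exact: (osc_large_of_holder n_gt0 alpha_gt0 fX.1.1.1 grep.2 gH).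
Qed.
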